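(* Let $N=\{1,\dots,n\}$, let $\mathcal{P}\subseteq\mathbb{R}^n$ be a compact set, and let $I\subseteq N$. Assume that there exists a finite collection of compact sets $P_I^j\subseteq\mathbb{R}^n$, $j\in J$, where $J$ is an index set, such that (i) $\dim \operatorname{proj}_{x_i}(P_I^j)=0$ for all $i\in N\setminus I$ and $j\in J$, i.e., coordinate $x_i$ is fixed on $P_I^j$; (ii) $\bigcup_{j\in J}\mathcal{X}(P_I^j)\subseteq \mathcal{P}\subseteq \bigcup_{j\in J}P_I^j$; (iii) for each $j\in J$ there exists a finite collection of hyper-rectangles of the form $R_j^k=\prod_{i=1}^n[l_i^k,u_i^k]$, $k\in K_j$, where $K_j$ is an index set (the bounds may depend on $j$), such that $\operatorname{conv}(P_I^j)=\operatorname{conv}\big(\bigcup_{k\in K_j}R_j^k\big)$. Then $$\max\{f(x)\mid x\in\mathcal{P}\}=\max\Big\{f(x)\,\Big|\, x\in\bigcup_{j\in J}\mathcal{X}(P_I^j)\Big\}=\max\Big\{f(x)\,\Big|\, x\in\bigcup_{j\in J}\bigcup_{k\in K_j}R_j^k\Big\}$$ for any function $f:\mathbb{R}^n\to\mathbb{R}$ that is convex in $x_I$.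
   Context: For $I\subseteq N$, $x_I$ denotes the coordinates of $x\in\mathbb{R}^n$ with index in $I$, and $\operatorname{proj}_{x_I}(P)$ is the projection of $P$ onto the space of variables $x_I$. $\operatorname{conv}(P)$ is the convex hull of $P$, and $\dim P$ is the dimension of $\operatorname{conv}(P)$. For a bounded set $P$, $\mathcal{X}(P)$ denotes the set of extreme points of $\operatorname{conv}(P)$. A function $f:\mathbb{R}^n\to\mathbb{R}$ is convex in $x_I$ if, for any values $\bar x_i\in\mathbb{R}$, $i\in N\setminus I$, the restriction of $f$ to $\{x\in\mathbb{R}^n\mid x_i=\bar x_i,\ \forall i\in N\setminus I\}$ is convex. Hyper-rectangles may be degenerate ($l_i^k=u_i^k$ is allowed). *)

(* Defs.v *)
(* R^n is 'rV[R]_n for R : realType, with coordinate index set N = 'I_n. *)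
From HB Require Import structures.
From mathcomp Require Export all_boot all_order all_algebra.
From mathcomp Require Export all_classical all_reals all_analysis.
Export Order.TTheory GRing.Theory Num.Theory.
Export numFieldNormedType.Exports.

Set Implicit Arguments.
Unset Strict Implicit.
Unset Printing Implicit Defensive.

#[export] Set Implicit Arguments.
#[export] Unset Strict Implicit.
#[export] Unset Printing Implicit Defensive.

Local Open Scope classical_set_scope.
Local Open Scope convex_scope.
Local Open Scope ring_scope.

Definition conv_hull (R : realType) (m : nat) (A : set 'rV[R]_m)
    : set 'rV[R]_m :=
  smallest (@convex_set R 'rV[R]_m) A.

(* The extreme points of the convex hull of A, not of A itself. *)
Definition extreme_points (R : realType) (m : nat) (A : set 'rV[R]_m)
    : set 'rV[R]_m :=
  [set x | conv_hull A x /\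
     forall (y z : convex_lmodType 'rV[R]_m) (t : {i01 R}),
       conv_hull A y -> conv_hull A z -> 0 < t%:num < 1 ->
       x = y <| t |> z -> y = x /\ z = x].

Definition affinely_independent (R : realType) (m k : nat)
    (p : 'I_k -> 'rV[R]_m) : Prop :=
  forall c : 'I_k -> R,
    \sum_(i < k) c i = 0 -> \sum_(i < k) c i *: p i = 0 ->
    forall i, c i = 0.

(* The maximal number of affinely independent points of the convex hull of A,
   minus one. At most m + 1 points of R^m are affinely independent, and the
   empty family is affinely independent, so dim A ranges over -1, ..., m and
   dim A = -1 exactly when A is empty. *)
Definition dim (R : realType) (m : nat) (A : set 'rV[R]_m) : int :=
  (\max_(k < m.+2 | `[< exists p : 'I_k -> 'rV[R]_m,
      (forall i, conv_hull A (p i)) /\ affinely_independent p >]) k)%N%:Z - 1.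

(* R^I is represented as 'rV[R]_#|I|, its coordinates being those indexed by I
   in increasing order. *)
Definition proj (R : realType) (n : nat) (I : {set 'I_n}) (A : set 'rV[R]_n)
    : set 'rV[R]_#|I| :=
  [set colsub (fun k : 'I_#|I| => enum_val k) x | x in A].

Arguments proj {R n} I A.

Definition hyper_rectangle (R : realType) (n : nat) (l u : 'rV[R]_n)
    : set 'rV[R]_n :=
  [set x | forall i, l 0 i <= x 0 i <= u 0 i].

Definition convex_in (R : realType) (n : nat) (I : {set 'I_n})
    (f : 'rV[R]_n -> R) : Prop :=
  forall xbar : 'rV[R]_n,
    @convex_function R 'rV[R]_n
      [set x : 'rV[R]_n | forall i, i \notin I -> x 0 i = xbar 0 i] f.

(* v is the maximum of f over A: the supremum, attained as soon as A is
   nonempty. The maximum over the empty set is -oo. *)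
Definition is_max (R : realType) (T : Type) (f : T -> R) (A : set T)
    (v : \bar R) : Prop :=
  v = ereal_sup [set (f x)%:E | x in A] /\
  (A !=set0 -> exists2 x, A x & (f x)%:E = v).

(* Main.v *)
Require Import Defs.
From mathcomp Require Import ring lra.

(** Write C_j for the convex hull of P_I^j, which is also the convex hull of
    the rectangles of index j. All three maxima are compared with the maximum
    over one finite set of points.

    A rectangle is the convex hull of its corners, so C_j is the convex hull
    of finitely many points, the corners of its rectangles
    ([conv_hull_rectangles]). Discarding, as long as possible, a point that
    lies in the hull of the remaining ones leaves a finite set W_j with the
    same hull C_j in which no point is redundant, and then every point of W_j
    is extreme in C_j ([conv_hull_extreme_seq]). Thus the union W of the W_j
    is contained in the union of the rectangles, in the set of extreme
    points, and hence in P.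

    Conversely each of these three sets is contained in the union of the C_j.
    The coordinates outside I are constant on P_I^j, so C_j lies in a slice
    on which f is convex, and therefore every value of f on C_j is at most
    one of its values on W_j ([convex_function_le_conv_hull]). A set that
    contains W and on which f is dominated by values on W has the same
    supremum as W, and attains it if it is nonempty
    ([is_max_dominating_seq]). If W is empty, then so are the three sets, and
    the common maximum is -oo. *)

Local Open Scope classical_set_scope.
Local Open Scope ring_scope.

(** * Convex sets and convex hulls *)

(** Convexity with a plain real weight instead of one bundled with its bounds,
    so that weights can be computed freely. *)
Lemma convex_setP (R : realType) (m : nat) (A : set 'rV[R]_m) :
  @convex_set R 'rV[R]_m A <->
  forall x y (t : R), 0 <= t -> t <= 1 -> A x -> A y ->
    A (t *: x + (1 - t) *: y).
Proof.
split=> [cA x y t t0 t1 Ax Ay|cA x y t /set_mem Ax /set_mem Ay].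
  have := cA x y (Itv01 t0 t1) (mem_set Ax) (mem_set Ay).
  by move/set_mem.
by apply/mem_set/cA.
Qed.

Lemma convex_set1 (R : realType) (m : nat) (w : 'rV[R]_m) :
  @convex_set R 'rV[R]_m [set w].
Proof.
apply/convex_setP => x y t _ _ /= -> ->.
by rewrite -scalerDl addrC subrK scale1r.
Qed.

Lemma conv_hull_convex (R : realType) (m : nat) (A : set 'rV[R]_m) :
  @convex_set R 'rV[R]_m (conv_hull A).
Proof.
apply/convex_setP => x y t t0 t1 Ax Ay B [cB AB].
by apply: (convex_setP _).1 => //; [apply: Ax|apply: Ay].
Qed.

Lemma sub_conv_hull (R : realType) (m : nat) (A : set 'rV[R]_m) :
  A `<=` conv_hull A.
Proof. exact: sub_gen_smallest. Qed.

Lemma conv_hull_sub (R : realType) (m : nat) (A B : set 'rV[R]_m) :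
  A `<=` conv_hull B -> conv_hull A `<=` conv_hull B.
Proof. by apply: smallest_sub; exact: conv_hull_convex. Qed.

Lemma conv_hull_setU1 (R : realType) (m : nat) (A : set 'rV[R]_m) w :
  conv_hull A w -> conv_hull (w |` A) = conv_hull A.
Proof.
move=> Aw; apply/seteqP; split; apply: conv_hull_sub.
  by move=> x [->|]//; exact: sub_conv_hull.
by move=> x Ax; apply: sub_conv_hull; right.
Qed.

Lemma eq_extreme_points (R : realType) (m : nat) (A B : set 'rV[R]_m) :
  conv_hull A = conv_hull B -> extreme_points A = extreme_points B.
Proof. by rewrite /extreme_points => ->. Qed.

(** The homogeneous form of convexity: the weights need not add up to 1. It
    merges the parts of two convex combinations that lie in D, including the
    degenerate case where both weights vanish. *)
Lemma convex_cone_comb (R : realType) (m : nat) (D : set 'rV[R]_m)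
    (a b : R) y z :
  @convex_set R 'rV[R]_m D -> 0 <= a -> 0 <= b -> D y -> D z ->
  exists2 v, D v & a *: y + b *: z = (a + b) *: v.
Proof.
move=> /convex_setP cD a0 b0 Dy Dz.
have [ab0|ab0] := eqVneq (a + b) 0.
  exists y => //; rewrite ab0.
  have [-> ->] : a = 0 /\ b = 0 by split; lra.
  by rewrite !scale0r addr0.
exists ((a / (a + b)) *: y + (1 - a / (a + b)) *: z).
  have ab_gt0 : 0 < a + b by rewrite lt_neqAle eq_sym ab0 addr_ge0.
  apply: cD => //; first by rewrite divr_ge0// ltW.
  by rewrite ler_pdivrMr// mul1r lerDl.
by rewrite scalerDr !scalerA; congr (_ *: _ + _ *: _); field.
Qed.

(** The join of a point with a convex set is convex. Nonemptiness of A
    provides the second end point for x = w, where t = 1. *)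
Lemma conv_hull_setU1_join (R : realType) (m : nat) (A : set 'rV[R]_m) w x :
  A !=set0 -> conv_hull (w |` A) x ->
  exists t v, [/\ 0 <= t, t <= 1, conv_hull A v & x = t *: w + (1 - t) *: v].
Proof.
case=> a Aa; move: x; apply: smallest_sub; last first.
  move=> x [->|Ax].
    exists 1, a; split=> //; first exact: sub_conv_hull.
    by rewrite subrr scale0r scale1r addr0.
  exists 0, x; split=> //; first exact: sub_conv_hull.
  by rewrite subr0 scale0r scale1r add0r.
apply/convex_setP => _ _ s s0 s1 [t [y [t0 t1 Ay ->]]] [r [z [r0 r1 Az ->]]].
have s1' : 0 <= 1 - s by lra.
have t1' : 0 <= 1 - t by lra.
have r1' : 0 <= 1 - r by lra.
have [v Av yzE] := convex_cone_comb (@conv_hull_convex _ _ A)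
  (mulr_ge0 s0 t1') (mulr_ge0 s1' r1') Ay Az.
exists (s * t + (1 - s) * r), v; split=> //; [nra|nra|].
have -> : 1 - (s * t + (1 - s) * r) = s * (1 - t) + (1 - s) * (1 - r) by ring.
by rewrite -yzE !scalerDr !scalerA addrACA -scalerDl.
Qed.

(** If w is a convex combination of two points of the hull of w and A, then
    splitting off the part of these points carried by w gives
    w = (1 - c) w + c v with v in the hull of A and c the total weight carried
    by A. Since w is not in that hull, w <> v and c = 0, which forces both
    points to be w. *)
Lemma extreme_points_setU1 (R : realType) (m : nat) (A : set 'rV[R]_m) w :
  ~ conv_hull A w -> extreme_points (w |` A) w.
Proof.
move=> nAw; split; first by apply: sub_conv_hull; left.
have [->|A0] := eqVneq A set0.
  have hull1 : conv_hull (w |` set0) `<=` [set w].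
    by rewrite setU0; apply: smallest_sub; first exact: convex_set1.
  by move=> y z t /hull1 -> /hull1 ->.
move/set0P in A0.
move=> y' z' t /(conv_hull_setU1_join A0)[a [y [a0 a1 Ay ->]]].
move=> /(conv_hull_setU1_join A0)[b [z [b0 b1 Az ->]]] /andP[].
set s := t%:num => s0 s1 wE.
have {}wE : w = s *: (a *: w + (1 - a) *: y)
              + (1 - s) *: (b *: w + (1 - b) *: z) := wE.
have a1' : 0 <= 1 - a by lra.
have b1' : 0 <= 1 - b by lra.
have s1' : 0 <= 1 - s by lra.
have [v Av yzE] := convex_cone_comb (@conv_hull_convex _ _ A)
  (mulr_ge0 (ltW s0) a1') (mulr_ge0 s1' b1') Ay Az.
pose c := s * (1 - a) + (1 - s) * (1 - b).
have cwv : c *: (w - v) = 0.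
  have wcv : w = (1 - c) *: w + c *: v.
    rewrite {1}wE -yzE !scalerDr !scalerA addrACA -scalerDl.
    by congr (_ *: _ + _); rewrite /c; ring.
  apply/eqP; rewrite scalerBr subr_eq0 -(inj_eq (addrI ((1 - c) *: w))) -wcv.
  by rewrite -scalerDl subrK scale1r.
have /eqP : c = 0.
  move/eqP: cwv; rewrite scaler_eq0 => /orP[/eqP//|].
  by rewrite subr_eq0 => /eqP wv; case: nAw; rewrite wv.
rewrite /c paddr_eq0 ?mulr_ge0// ?(ltW s0)// !mulf_eq0 => /andP[].
rewrite (gt_eqF s0) (_ : 1 - s == 0 = false) /=; last by apply/negbTE; lra.
rewrite !subr_eq0 => /eqP <- /eqP <-.
by rewrite subrr !scale0r scale1r !addr0.
Qed.

(** * Polytopes and rectangles *)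

(** The finite case of Minkowski's theorem: an irredundant set of generators
    of a polytope consists of extreme points. *)
Lemma conv_hull_extreme_seq (R : realType) (m : nat) (s : seq 'rV[R]_m) :
  exists s' : seq 'rV[R]_m,
    [/\ {subset s' <= s}, conv_hull [set` s'] = conv_hull [set` s] &
        [set` s'] `<=` extreme_points [set` s]].
Proof.
have [k] := ubnP (size s); elim: k s => // k IHk s; rewrite ltnS => sk.
have sE w : w \in s -> [set` s] = w |` [set` [seq v <- s | v != w]].
  move=> sw; apply/seteqP; split=> x /=.
    by move=> sx; case: (eqVneq x w) => [->|xw]; [left|right; rewrite mem_filter xw].
  by case=> [->//|]; rewrite mem_filter => /andP[].
have [[w sw hw]|irr] :=
  pselect (exists2 w, w \in s & conv_hull [set` [seq v <- s | v != w]] w).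
  have hE : conv_hull [set` [seq v <- s | v != w]] = conv_hull [set` s].
    by rewrite [in RHS](sE _ sw) conv_hull_setU1.
  case: (IHk [seq v <- s | v != w]) => [|s' [s's s'h s'e]].
    apply: leq_trans sk; rewrite size_filter -(count_predC (pred1 w)).
    by rewrite -[ltnLHS]add0n ltn_add2r -has_count has_pred1.
  exists s'; split.
  - by move=> x /s's; rewrite mem_filter => /andP[].
  - by rewrite s'h.
  - by rewrite -(eq_extreme_points hE).
exists s; split=> // w /= sw; rewrite (sE _ sw); apply: extreme_points_setU1.
by move=> hw; apply: irr; exists w.
Qed.

Definition rect_vertex (R : realType) (n : nat) (l u : 'rV[R]_n)
    (S : {set 'I_n}) : 'rV[R]_n :=
  \row_i (if i \in S then u 0 i else l 0 i).

Lemma hyper_rectangle_vertex (R : realType) (n : nat) (l u : 'rV[R]_n) S :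
  (forall i, l 0 i <= u 0 i) -> hyper_rectangle l u (rect_vertex l u S).
Proof. by move=> lu i; rewrite mxE; case: ifP; rewrite lexx lu. Qed.

(** A coordinate x_i strictly between its bounds writes x as a convex
    combination of the two points obtained by moving x_i to either bound.
    These have fewer such coordinates, and a point without any is a corner. *)
Lemma hyper_rectangle_sub (R : realType) (n : nat) (l u : 'rV[R]_n)
    (C : set 'rV[R]_n) :
  @convex_set R 'rV[R]_n C -> (forall S, C (rect_vertex l u S)) ->
  hyper_rectangle l u `<=` C.
Proof.
move=> /convex_setP cC Cv x.
have [k] := ubnP #|[set i | l 0 i < x 0 i < u 0 i]%SET|.
elim: k x => // k IHk x; rewrite ltnS => xk Rx.
have [x0|[i]] := set_0Vmem [set i | l 0 i < x 0 i < u 0 i]%SET.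
  suff -> : x = rect_vertex l u [set i | x 0 i == u 0 i]%SET by exact: Cv.
  apply/rowP => i; rewrite mxE inE; case: eqP => // /eqP xu.
  have /negbT : (i \in [set i | l 0 i < x 0 i < u 0 i]%SET) = false.
    by rewrite x0 finset.in_set0.
  rewrite inE.
  have /andP[lx ux] := Rx i.
  by rewrite !lt_neqAle lx ux xu !andbT => /negPn/eqP ->.
rewrite inE => /andP[lx xu].
pose xi a : 'rV[R]_n := \row_j (if j == i then a else x 0 j).
have Cxi a : a = l 0 i \/ a = u 0 i -> C (xi a).
  move=> aE; apply: IHk.
    apply: leq_trans xk; apply/proper_card/properP; split.
      apply/fintype.subsetP => j; rewrite !inE mxE; case: eqP => // ->.
      by case: aE => ->; rewrite ltxx ?andbF.
    exists i; rewrite !inE ?lx ?xu// mxE eqxx.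
    by case: aE => ->; rewrite ltxx ?andbF.
  move=> j; rewrite mxE; case: eqP => [->|_]; last exact: Rx.
  have lu : l 0 i <= u 0 i by lra.
  by case: aE => ->; rewrite lexx lu.
pose t := (u 0 i - x 0 i) / (u 0 i - l 0 i).
have lu : 0 < u 0 i - l 0 i by lra.
suff -> : x = t *: xi (l 0 i) + (1 - t) *: xi (u 0 i).
  apply: cC; [| |by apply: Cxi; left|by apply: Cxi; right].
    by rewrite divr_ge0 ?ltW//; lra.
  by rewrite ler_pdivrMr//; lra.
apply/rowP => j; rewrite !mxE; case: eqP => [->|_]; last by ring.
by rewrite /t; field; rewrite gt_eqF.
Qed.

Lemma conv_hull_rectangles (R : realType) (n : nat) (K : finType)
    (l u : K -> 'rV[R]_n) :
  (forall k i, l k 0 i <= u k 0 i) ->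
  exists s : seq 'rV[R]_n,
    [set` s] `<=` \bigcup_(k in [set: K]) hyper_rectangle (l k) (u k) /\
    conv_hull [set` s] =
    conv_hull (\bigcup_(k in [set: K]) hyper_rectangle (l k) (u k)).
Proof.
move=> lu.
pose s := [seq rect_vertex (l p.1) (u p.1) p.2 | p <- enum {: K * {set 'I_n}}].
have sR : [set` s] `<=` \bigcup_(k in [set: K]) hyper_rectangle (l k) (u k).
  by move=> _ /mapP[[k S] _ ->]; exists k => //; apply: hyper_rectangle_vertex.
exists s; split=> //; apply/seteqP; split; apply: conv_hull_sub.
  by move=> x /sR; exact: sub_conv_hull.
move=> x [k _]; apply: hyper_rectangle_sub; first exact: conv_hull_convex.
move=> S; apply: sub_conv_hull; apply/mapP.
by exists (k, S) => //; rewrite mem_enum.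
Qed.

(** * Coordinates fixed by a zero-dimensional projection *)

(** Two distinct points are affinely independent, so they force dim A >= 1. *)
Lemma dim0_eq (R : realType) (m : nat) (A : set 'rV[R]_m) x y :
  dim A = 0 -> A x -> A y -> x = y.
Proof.
case: m A x y => [|m] A x y dimA Ax Ay; first by rewrite (thinmx0 x) (thinmx0 y).
apply/eqP/negPn/negP => xy.
move: dimA => /eqP; rewrite /dim subr_eq0 => /eqP[] dim1.
have lt2 : (2 < m.+3)%N by [].
suff : (2 <= 1)%N by [].
rewrite -[leqRHS]dim1 -[2%N]/(nat_of_ord (Ordinal lt2)).
apply: (leq_bigmax_cond (Ordinal lt2)).
apply/asboolP; exists (fun i : 'I_2 => if i == 0 then x else y); split.
  by move=> i; case: ifP => _; exact: sub_conv_hull.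
move=> c; rewrite !big_ord_recl !big_ord0 /= !addr0.
set c0 := c ord0; set c1 := c _ => c01 /eqP.
have -> : c1 = - c0 by lra.
rewrite scaleNr -scalerBr scaler_eq0 subr_eq0 (negbTE xy) orbF => /eqP c00 i.
case: (unliftP ord0 i) => [j ->|-> //]; rewrite ord1 -/c1; lra.
Qed.

Lemma proj1_dim0_eq (R : realType) (n : nat) (A : set 'rV[R]_n) i x y :
  dim (proj [set i]%SET A) = 0 -> A x -> A y -> x 0 i = y 0 i.
Proof.
move=> dimA Ax Ay.
have := dim0_eq dimA (imageP _ Ax) (imageP _ Ay).
have i1 : i \in [set i]%SET by rewrite inE.
by move=> /rowP /(_ (enum_rank_in i1 i)); rewrite !mxE enum_rankK_in.
Qed.

Lemma convex_slice (R : realType) (n : nat) (I : {set 'I_n}) (xbar : 'rV[R]_n) :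
  @convex_set R 'rV[R]_n [set x | forall i, i \notin I -> x 0 i = xbar 0 i].
Proof.
apply/convex_setP => x y t _ _ /= xE yE i iI.
by rewrite !mxE xE// yE//; ring.
Qed.

(** * Maxima of convex functions *)

(** The points of D whose value is at most some value on A form a convex set:
    the value at a convex combination is at most the larger of the two values
    at its ends. *)
Lemma convex_function_le_conv_hull (R : realType) (m : nat)
    (A D : set 'rV[R]_m) (f : 'rV[R]_m -> R) :
  @convex_set R 'rV[R]_m D -> @convex_function R 'rV[R]_m D f -> A `<=` D ->
  conv_hull A `<=` [set x | exists2 w, A w & f x <= f w].
Proof.
move=> cD cf AD.
suff : conv_hull A `<=` D `&` [set x | exists2 w, A w & f x <= f w].
  by move=> + x Ax => /(_ _ Ax) [].
apply: smallest_sub; last by move=> x Ax; split; [exact: AD|exists x].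
apply/convex_setP => x y t t0 t1 [Dx [v Av xv]] [Dy [w Aw yw]].
split; first exact: (convex_setP _).1.
have fxy : f (t *: x + (1 - t) *: y) <= t * f x + (1 - t) * f y :=
  cf (Itv01 t0 t1) x y (mem_set Dx) (mem_set Dy).
have le_max M : f v <= M -> f w <= M -> t * f x + (1 - t) * f y <= M.
  by move=> vM wM; nra.
have [vw|wv] := leP (f v) (f w); [exists w|exists v] => //.
  by apply: le_trans fxy _; exact: le_max.
by apply: le_trans fxy _; apply: le_max => //; exact: ltW.
Qed.

Lemma seq_argmax (R : realType) (T : eqType) (f : T -> R) (s : seq T) x :
  x \in s -> exists2 w, w \in s & forall v, v \in s -> f v <= f w.
Proof.
elim: s x => // a [_|b s IHs] x _.
  by exists a => [|v]; rewrite !inE// => /eqP ->.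
have [w ws wmax] := IHs b (mem_head b s).
have [aw|wa] := leP (f a) (f w).
  exists w; first by rewrite in_cons ws orbT.
  by move=> v; rewrite in_cons => /orP[/eqP ->|/wmax].
exists a; first exact: mem_head.
move=> v; rewrite in_cons => /orP[/eqP ->//|/wmax fv].
exact: le_trans fv (ltW wa).
Qed.

(** The candidate value depends on s alone, so that it serves every set A
    that lies between s and the set dominated by s. *)
Lemma is_max_dominating_seq (R : realType) (T : eqType) (f : T -> R)
    (s : seq T) (A : set T) :
  [set` s] `<=` A -> A `<=` [set x | exists2 w, w \in s & f x <= f w] ->
  is_max f A (ereal_sup [set (f x)%:E | x in [set` s]]).
Proof.
move=> sA As.
have supE : ereal_sup [set (f x)%:E | x in [set` s]] =
            ereal_sup [set (f x)%:E | x in A].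
  apply/eqP; rewrite eq_le; apply/andP; split.
    by apply: ereal_sup_le; exact: image_subset.
  apply: ge_ereal_sup => _ [x /As[w sw xw] <-].
  apply: (@le_trans _ _ (f w)%:E); first by rewrite lee_fin.
  by apply: ereal_sup_ubound; exists w.
split=> // -[x /As[w sw _]]; have [v sv vmax] := seq_argmax f sw.
exists v; first exact: sA.
apply/eqP; rewrite eq_le; apply/andP; split.
  by apply: ereal_sup_ubound; exists v.
by apply: ge_ereal_sup => _ [y sy <-]; rewrite lee_fin vmax.
Qed.

Theorem theorem1 (R : realType) (n : nat) (P : set 'rV[R]_n)
    (I : {set 'I_n}) (J : finType) (PI : J -> set 'rV[R]_n)
    (K : J -> finType) (l u : forall j : J, K j -> 'rV[R]_n)
    (cptP : compact P)
    (cptPI : forall j : J, compact (PI j))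
    (fixed : forall (i : 'I_n) (j : J), i \notin I ->
      dim (proj [set i]%SET (PI j)) = 0)
    (extr_sub : \bigcup_(j in [set: J]) extreme_points (PI j) `<=` P)
    (sub_cover : P `<=` \bigcup_(j in [set: J]) PI j)
    (le_lu : forall (j : J) (k : K j) (i : 'I_n), l j k 0 i <= u j k 0 i)
    (conv_rect : forall j : J,
      conv_hull (PI j) =
      conv_hull (\bigcup_(k in [set: K j]) hyper_rectangle (l j k) (u j k))) :
  forall f : 'rV[R]_n -> R, convex_in I f ->
  exists v : \bar R,
    [/\ is_max f P v,
        is_max f (\bigcup_(j in [set: J]) extreme_points (PI j)) v &
        is_max f (\bigcup_(j in [set: J]) \bigcup_(k in [set: K j])
                    hyper_rectangle (l j k) (u j k)) v].
Proof.
move=> f cf.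
have /choice[W WP] (j : J) : exists s : seq 'rV[R]_n,
    [/\ [set` s] `<=` \bigcup_(k in [set: K j]) hyper_rectangle (l j k) (u j k),
        conv_hull [set` s] = conv_hull (PI j) &
        [set` s] `<=` extreme_points (PI j)].
  have [s [sR sh]] := conv_hull_rectangles (le_lu j).
  have [s' [s's s'h s'e]] := conv_hull_extreme_seq s.
  rewrite -conv_rect in sh.
  exists s'; split; first by move=> x /s's /sR.
    by rewrite s'h.
  by rewrite -(eq_extreme_points sh).
have dom (j : J) x : conv_hull (PI j) x -> exists2 w, w \in W j & f x <= f w.
  have [_ Wh _] := WP j.
  (* A point of PI j is needed to name the slice; an empty PI j has an empty
     hull. *)
  have [->|/set0P[a PIa]] := eqVneq (PI j) set0.
    have : conv_hull set0 `<=` (set0 : set 'rV[R]_n).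
      by apply: smallest_sub => //; apply/convex_setP.
    by move=> h0 /h0.
  have PIs : PI j `<=` [set x | forall i, i \notin I -> x 0 i = a 0 i].
    by move=> y PIy i iI; exact: (proj1_dim0_eq (fixed i j iI)).
  rewrite -Wh => Wx.
  apply: (convex_function_le_conv_hull (@convex_slice _ _ I a) (cf a)) Wx.
  apply: subset_trans (@sub_conv_hull _ _ _) _; rewrite Wh.
  by apply: smallest_sub => //; exact: convex_slice.
pose s := flatten [seq W j | j <- enum J].
have sE x : x \in s <-> exists j, x \in W j.
  split=> [/flatten_mapP[j _ ?]|[j ?]]; first by exists j.
  by apply/flatten_mapP; exists j => //; rewrite mem_enum.
have sD A : [set` s] `<=` A ->
    A `<=` \bigcup_(j in [set: J]) conv_hull (PI j) ->
    is_max f A (ereal_sup [set (f x)%:E | x in [set` s]]).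
  move=> sA AD; apply: is_max_dominating_seq => // x /AD[j _ /dom[w Ww xw]].
  by exists w => //; apply/sE; exists j.
have sX : [set` s] `<=` \bigcup_(j in [set: J]) extreme_points (PI j).
  by move=> x /sE[j Wx]; exists j => //; have [_ _] := WP j; apply.
exists (ereal_sup [set (f x)%:E | x in [set` s]]); split; apply: sD => //.
- exact: subset_trans extr_sub.
- by move=> x /sub_cover[j _ PIx]; exists j => //; exact: sub_conv_hull.
- by move=> x [j _ [xh _]]; exists j.
- by move=> x /sE[j Wx]; exists j => //; have [+ _ _] := WP j; apply.
- by move=> x [j _ Rx]; exists j => //; rewrite conv_rect; exact: sub_conv_hull.
Qed.
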